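(* Let $0<\epsilon<1$ be given. Then for some constants $c',c''\in(0,1)$ and all integers $N\geq n\geq1$, there is an (explicitly given) function $\psi\colon\{0,1,2,\dots,N\}\to\mathbb{R}$ such that $\psi(0)>\frac{1-\epsilon}{2}$; $\|\psi\|_1=1$; $\operatorname{orth}\psi\geq c'\sqrt{n}$; $\operatorname{sign}\psi(t)=(-1)^t$ for $t=0,1,\dots,N$; and \[ |\psi(t)|\in\left[\frac{c'}{(t+1)^2\,2^{c''t/\sqrt n}},\ \frac{1}{c'(t+1)^2\,2^{c''t/\sqrt n}}\right],\qquad t=0,1,2,\dots,N. \]
   Context: $\|\psi\|_1=\sum_t|\psi(t)|$. For a real function $\psi$ on a finite subset of $\mathbb{R}$, $\operatorname{orth}\psi$ is the minimum degree of a real univariate polynomial $p$ with $\sum_t\psi(t)p(t)\ne0$ ($\infty$ if none exists). The constants $c',c''$ depend only on $\epsilon$. *)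

(* Defs.v *)
From HB Require Import structures.
From mathcomp Require Import all_boot all_order all_algebra.
From mathcomp Require Import all_classical all_reals all_analysis.

Set Implicit Arguments.
Unset Strict Implicit.
Unset Printing Implicit Defensive.

Import Order.TTheory GRing.Theory Num.Theory.

Local Open Scope classical_set_scope.
Local Open Scope ring_scope.

(* A function on {0, 1, ..., N} is psi : 'I_N.+1 -> R, where t : 'I_N.+1 is the
   point t%:R of the real line. *)

Definition norm1 (R : realType) (N : nat) (psi : 'I_N.+1 -> R) : R :=
  \sum_t `|psi t|.

Definition correlates (R : realType) (N : nat) (psi : 'I_N.+1 -> R)
    (p : {poly R}) : Prop :=
  \sum_t psi t * p.[(t : nat)%:R] <> 0.

(* Minimum degree of a polynomial that correlates with psi. The infimum is over
   natural numbers, hence attained when the set is nonempty (lemma orth_attained);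
   the infimum of the empty set is +oo. The zero polynomial never
   correlates with psi, so (size p).-1 is the degree of p. *)
Definition orth (R : realType) (N : nat) (psi : 'I_N.+1 -> R) : \bar R :=
  ereal_inf [set ((size p).-1%:R)%:E | p in [set p | correlates psi p]].

Lemma orth_attained (R : realType) (N : nat) (psi : 'I_N.+1 -> R)
    (q : {poly R}) : correlates psi q ->
  exists2 p, correlates psi p & orth psi = ((size p).-1%:R)%:E.
Proof.
move=> hq.
have ex : exists d, `[< exists2 p, correlates psi p & (size p).-1 = d >].
  by exists (size q).-1; apply/asboolP; exists q.
case: (ex_minnP ex) => d /asboolP[p hp <-] hmin.
exists p => //; apply/eqP; rewrite eq_le; apply/andP; split.
  by apply: ereal_inf_lbound; exists p.
apply: le_ereal_inf_tmp => _ [r hr <-].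
by rewrite lee_fin ler_nat hmin//; apply/asboolP; exists r.
Qed.

Lemma orth_infinite (R : realType) (N : nat) (psi : 'I_N.+1 -> R) :
  (forall p, ~ correlates psi p) -> orth psi = +oo%E.
Proof.
move=> h; rewrite /orth (_ : [set p | correlates psi p] = set0).
  by rewrite image_set0 ereal_inf0.
by apply/seteqP; split => p // /h.
Qed.

(* Main.v *)
Require Import Defs.
From HB Require Import structures.
From mathcomp Require Import all_boot all_order all_algebra.
From mathcomp Require Import all_classical all_reals all_analysis.
From mathcomp Require Import ring lra zify.

Set Implicit Arguments.
Unset Strict Implicit.
Unset Printing Implicit Defensive.

Import Order.TTheory GRing.Theory Num.Theory.

Local Open Scope ring_scope.

(* Divided differences over k + 1 nodes annihilate all polynomials of degree
   below k, and their weights alternate in sign along the nodes. For the nodes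
   0, 1, A and Delta i^2 (1 <= i <= d), with A even, Delta odd and
   A << Delta, the i-th node has the parity of i, so the weight at t has sign
   (-1)^t. Relative to the weight at 0, the weight at t = Delta i^2 is
   2 A d!^2 / ((t - 1) (t - A) (d - i)! (d + i)!), at most of order
   t^-2 2^(- i^2 / 2 d), and the one at A is O(1 / A); since the weights of the
   even nodes and of the odd nodes balance, 0 carries nearly half of the mass.
   With d of order sqrt n this is psi up to its zeros. To fill these, add a
   small multiple of the sum over T of h(T) times a copy of this function
   placed at T, where h(t) = (t + 1)^-2 2^(- c t / sqrt n) is the target size;
   the sum is again O(h), because the convolution of h with itself is at most
   8 h. *)

(** * Divided differences with alternating weights *)

(** The sum is the coefficient of degree [k] of the Lagrange interpolant [q] of [p]. Both
    polynomials have size at most [k.+1] and agree at [k.+1] points, so [q = p], whose coefficient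
    there vanishes. *)
Lemma divided_difference_eq0 (F : fieldType) (k : nat) (x : 'I_k.+1 -> F)
    (p : {poly F}) : injective x -> (size p <= k)%N ->
  \sum_i p.[x i] / \prod_(j | j != i) (x i - x j) = 0.
Proof.
move=> inj_x le_pk.
pose ell i : {poly F} := \prod_(j | j != i) ('X - (x j)%:P).
have ellE i : ell i = \prod_(j <- enum (predC1 i)) ('X - (x j)%:P).
  by rewrite big_enum.
have size_ell i : size (ell i) = k.+1.
  by rewrite ellE size_prod_XsubC -cardE cardC1 card_ord.
have ell_k i : (ell i)`_k = 1.
  have /monicP : ell i \is monic by apply: monic_prod_XsubC.
  by rewrite /lead_coef size_ell.
have ell_x i : (ell i).[x i] = \prod_(j | j != i) (x i - x j).
  by rewrite horner_prod; apply: eq_bigr => j _; rewrite !hornerE.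
have ell_x0 i m : m != i -> (ell i).[x m] = 0.
  move=> ne_mi; rewrite horner_prod (bigD1 m) //= !hornerE subrr.
  by rewrite mul0r.
pose c i := p.[x i] / \prod_(j | j != i) (x i - x j).
pose q := \sum_i c i *: ell i.
have q_x m : q.[x m] = p.[x m].
  rewrite horner_sum (bigD1 m) //= big1 ?addr0 => [|i ne_im]; last first.
    by rewrite hornerZ ell_x0 ?mulr0 // eq_sym.
  rewrite hornerZ ell_x /c mulfVK //; apply/prodf_neq0 => j ne_jm.
  by rewrite subr_eq0 (inj_eq inj_x) eq_sym.
have /subr0_eq eq_qp : q - p = 0.
  apply: (@roots_geq_poly_eq0 _ _ (codom x)).
  - by apply/allP => _ /codomP[i ->]; rewrite rootE !hornerE q_x subrr.
  - by rewrite map_inj_uniq ?enum_uniq.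
  rewrite size_codom card_ord (leq_trans (size_polyD _ _)) // geq_max.
  rewrite size_polyN (leq_trans le_pk) ?leqnSn // andbT.
  apply: (leq_trans (size_sum _ _ _)); apply/bigmax_leqP => i _.
  by apply: leq_trans (size_scale_leq _ _) _; rewrite size_ell.
have : q`_k = 0 by rewrite eq_qp nth_default.
rewrite coef_sum => q_k; rewrite -[RHS]q_k; apply: eq_bigr => i _.
by rewrite coefZ ell_k mulr1.
Qed.

(** For [i < k] and distinct nodes, this is the absolute value at the [i]-th node of the derivative
    of the monic polynomial whose roots are the first [k] nodes. *)
Definition gap (F : realFieldType) (s : nat -> nat) (k i : nat) : F :=
  \prod_(j < k | j != i :> nat) `|(s i)%:R - (s j)%:R|.

Section Gap.
Variables (F : realFieldType) (s : nat -> nat).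
Hypothesis s_incr : {homo s : i j / (i < j)%N}.

Let s_inj : injective s.
Proof.
by move=> i j eq_s; case: (ltngtP i j) => // /s_incr; rewrite eq_s ltnn.
Qed.

Lemma gap_gt0 k i : 0 < gap F s k i.
Proof.
apply: prodr_gt0 => j ne_ji; rewrite normr_gt0 subr_eq0 eqr_nat.
by rewrite (inj_eq s_inj) eq_sym.
Qed.

(** As the nodes increase, the negative factors are exactly the [k - i] ones with [i < j]. *)
Lemma prod_sub_gap k (i : 'I_k.+1) :
  \prod_(j < k.+1 | j != i) ((s i)%:R - (s j)%:R) =
  (-1) ^+ (k - i) * gap F s k.+1 i.
Proof.
have sgE (j : 'I_k.+1) : j != i -> (s i)%:R - (s j)%:R =
    (-1) ^+ (i < j)%N * `|(s i)%:R - (s j)%:R| :> F.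
  rewrite -val_eqE /= => ne_ji; case: (ltngtP i j) ne_ji => // [lt_ij|lt_ji] _.
    by rewrite expr1 ltr0_norm ?mulN1r ?opprK // subr_lt0 ltr_nat s_incr.
  by rewrite expr0 mul1r gtr0_norm // subr_gt0 ltr_nat s_incr.
rewrite (eq_bigr _ sgE) big_split /= prodrXr; congr (_ ^+ _ * _).
rewrite big_mkcond (eq_bigr (fun j : 'I_k.+1 => (i < j)%N : nat)) /=; last first.
  by move=> j _; rewrite -val_eqE /=; case: ltngtP.
rewrite -(big_mkord xpredT (fun j => (i < j)%N : nat)).
rewrite (big_cat_nat (n := i.+1)) //= big_nat big1 => [|j]; last first.
  by rewrite ltnS => /andP[_]; rewrite ltnNge => ->.
rewrite add0n (eq_big_nat _ _ (F2 := fun=> 1%N)) => [|j /andP[->]//].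
by rewrite sum_nat_const_nat muln1 subSS.
Qed.

Lemma alternating_gap_eq0 k (p : {poly F}) : (size p <= k)%N ->
  \sum_(i < k.+1) (-1) ^+ i / gap F s k.+1 i * p.[(s i)%:R] = 0.
Proof.
move=> le_pk; pose x (i : 'I_k.+1) : F := (s i)%:R.
have inj_x : injective x.
  by move=> i j /eqP; rewrite eqr_nat => /eqP/s_inj/val_inj.
have dd0 := divided_difference_eq0 inj_x le_pk.
transitivity ((-1) ^+ k * \sum_i p.[x i] / \prod_(j | j != i) (x i - x j)).
  rewrite mulr_sumr; apply: eq_bigr => i _.
  have -> : (-1) ^+ k = (-1) ^+ (k - i) * (-1) ^+ i :> F.
    by rewrite -exprD subnK // leq_ord.
  rewrite prod_sub_gap invfM invr_sign.
  set a := (-1) ^+ (k - i).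
  have aa : a * a = 1 by rewrite -expr2 sqrr_sign.
  rewrite -[p.[x i]]/(p.[(s i)%:R]).
  have -> (b y g : F) : a * b * (y * (a / g)) = (a * a) * (b / g * y) by ring.
  by rewrite aa mul1r.
by rewrite dd0 mulr0.
Qed.
End Gap.

(** * Elementary sums and products, and ratios of central binomial coefficients *)

Lemma sum_inv_sq_le2 (F : realFieldType) (n : nat) :
  \sum_(i < n) (i.+1%:R ^- 2 : F) <= 2.
Proof.
case: n => [|n]; first by rewrite big_ord0.
(* The bound is strengthened so that the induction telescopes: [1/x - 1/(x + 1)] exceeds
   [1/(x + 1)^2]. *)
suff : \sum_(i < n.+1) (i.+1%:R ^- 2 : F) <= 2 - n.+1%:R^-1.
  by move/le_trans; apply; rewrite gerBl invr_ge0.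
elim: n => [|n IHn]; first by rewrite big_ord1 expr1n !invr1; lra.
rewrite big_ord_recr /=; apply: le_trans (lerD IHn (lexx _)) _.
have x_gt0 : 0 < n.+1%:R :> F by rewrite ltr0n.
rewrite -[n.+2]addn1 natrD; move: (n.+1%:R) x_gt0 => x x_gt0.
rewrite -subr_ge0 [leRHS](_ : _ = x^-1 / (x + 1) ^+ 2).
  by rewrite mulr_ge0 ?invr_ge0 ?exprn_ge0 //; lra.
by field; rewrite !gt_eqF //; lra.
Qed.

(** Weierstrass's product inequality: [(1 - x) (1 - S) >= 1 - x - S] for [x] and [S] nonnegative. *)
Lemma prod1B_ge (F : realFieldType) (n : nat) (x : 'I_n -> F) :
  (forall i, 0 <= x i <= 1) -> 1 - \sum_i x i <= \prod_i (1 - x i).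
Proof.
elim: n x => [|n IHn] x x01; first by rewrite !big_ord0 subr0.
rewrite !big_ord_recl; set P := \prod_(_ < _) _; set S := \sum_(_ < _) _.
have leSP : 1 - S <= P by apply: IHn.
have S_ge0 : 0 <= S by apply: sumr_ge0 => i _; case/andP: (x01 (lift ord0 i)).
by have /andP[] := x01 ord0; nra.
Qed.

(** Each factor splits into a difference and a sum; the differences multiply to [i! / (i - m)!] and
    the sums to [(i + 1 + m)! / (i + 1)!]. *)
Lemma prod_sqr_sub (F : realFieldType) (i m : nat) : (m <= i)%N ->
  (\prod_(j < m) (i.+1%:R ^+ 2 - j.+1%:R ^+ 2)) * (i - m)`!%:R * i.+1%:R =
  (i.+1 + m)`!%:R :> F.
Proof.
elim: m => [|m IHm] lt_mi.
  by rewrite big_ord0 mul1r subn0 addn0 factS natrM mulrC.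
have := IHm (ltnW lt_mi); rewrite big_ord_recr /= addnS factS natrM => <-.
have -> : (i - m = (i - m.+1).+1)%N by lia.
rewrite factS !natrM; have -> : (i - m.+1).+1%:R = i.+1%:R - m.+1%:R :> F.
  by rewrite -natrB ?ltnS 1?ltnW //; congr (_%:R); lia.
have -> : (i.+1 + m).+1%:R = i.+1%:R + m.+1%:R :> F by rewrite -natrD addnS.
by ring.
Qed.

(** Induction on [d], starting at [d = i.+1], where all other squares are smaller. Each later square
    contributes one new factor to each of the two factorials. *)
Lemma prod_dist_sqr (F : realFieldType) (d i : nat) : (i < d)%N ->
  (\prod_(j < d | j != i :> nat) `|i.+1%:R ^+ 2 - j.+1%:R ^+ 2|) *
    (2 * i.+1%:R ^+ 2) = (d - i.+1)`!%:R * (d + i.+1)`!%:R :> F.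
Proof.
elim: d => [//|d IHd]; rewrite ltnS leq_eqVlt => /predU1P[<-|lt_id].
  rewrite big_mkcond big_ord_recr /= eqxx mulr1 -big_mkcond /= subnn mul1r.
  rewrite (eq_bigl xpredT) => [|j]; last by rewrite neq_ltn ltn_ord.
  rewrite (eq_bigr (fun j : 'I_i => i.+1%:R ^+ 2 - j.+1%:R ^+ 2)); last first.
    move=> j _; rewrite ger0_norm // subr_ge0 -!natrX ler_nat leq_sqr.
    by rewrite ltnS ltnW.
  rewrite addnS factS natrM -(prod_sqr_sub F (leqnn i)) subnn mulr1.
  have -> : (i.+1 + i).+1%:R = 2 * i.+1%:R :> F.
    by rewrite -natrM; congr (_%:R); lia.
  by ring.
rewrite big_mkcond big_ord_recr /= -big_mkcond /= eq_sym neq_ltn lt_id /=.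
rewrite mulrAC IHd // subSS addSn factS ler0_norm; last first.
  by rewrite subr_le0 -!natrX ler_nat leq_sqr ltnS ltnW.
have -> : (d - i = (d - i.+1).+1)%N by lia.
rewrite factS !natrM; have -> : (d - i.+1).+1%:R = d.+1%:R - i.+1%:R :> F.
  by rewrite -natrB ?ltnS 1?ltnW //; congr (_%:R); lia.
have -> : (d + i.+1).+1%:R = d.+1%:R + i.+1%:R :> F by rewrite -natrD addSn.
by ring.
Qed.

(** This is what the square nodes contribute to a weight relative to the weight at 0. Up to the
    factor 2 it is the binomial coefficient of [2 d] over [d + i + 1] divided by the central one. *)
Lemma prod_sqr_ratio (F : realFieldType) (d i : nat) : (i < d)%N ->
  \prod_(j < d | j != i :> nat)
     (j.+1%:R ^+ 2 / `|i.+1%:R ^+ 2 - j.+1%:R ^+ 2|) =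
  2 * (d`!%:R ^+ 2 / ((d - i.+1)`!%:R * (d + i.+1)`!%:R)) :> F.
Proof.
move=> lt_id; rewrite big_split /= prodfV.
have factE : d`!%:R ^+ 2 = i.+1%:R ^+ 2 *
    \prod_(j < d | j != i :> nat) j.+1%:R ^+ 2 :> F.
  rewrite (_ : d`!%:R = \prod_(j < d) j.+1%:R); last first.
    by rewrite fact_prod big_add1 big_mkord natr_prod.
  by rewrite -prodrXl (bigD1 (Ordinal lt_id)).
rewrite factE -(prod_dist_sqr F lt_id); set P := \prod_(_ < _ | _) _.
set E := \prod_(_ < _ | _) _; have E_neq0 : E != 0.
  apply/prodf_neq0 => j ne_ji.
  by rewrite normr_eq0 subr_eq0 -!natrX eqr_nat eqn_sqr eqSS eq_sym.
have : i.+1%:R != 0 :> F by rewrite pnatr_eq0.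
move: (i.+1%:R) P E E_neq0 => x P E E_neq0 x_neq0.
by field; rewrite E_neq0 x_neq0.
Qed.

Lemma sub1_le_pow2N (R : realType) (x : R) : 0 <= x -> 1 - x <= 2 `^ (- x).
Proof.
move=> x_ge0; apply: le_trans (expR_ge1Dx (- x)) _.
rewrite /powR pnatr_eq0 /= ler_expR mulNr lerN2 ler_piMr //.
have := @le_ln1Dx R 1; rewrite -natr1 mulr1n; apply; lra.
Qed.

(** Passing from [i] to [i + 1] multiplies the ratio by [1 - (2 i + 1) / (d + i + 1)]. This is at
    most [2^(- (2 i + 1) / (2 d))] because [d + i + 1 <= 2 d], and the odd numbers add up to a
    square. *)
Lemma central_ratio_le (R : realType) (d i : nat) : (i <= d)%N ->
  d`!%:R ^+ 2 / ((d - i)`!%:R * (d + i)`!%:R) <=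
  2 `^ (- (i%:R ^+ 2 / (2 * d%:R))) :> R.
Proof.
elim: i => [|i IHi] lt_id.
  by rewrite subn0 addn0 expr0n mul0r oppr0 powRr0 -expr2 divff //.
have d_gt0 : 0 < d%:R :> R by rewrite ltr0n (leq_trans _ lt_id).
have -> : d`!%:R ^+ 2 / ((d - i.+1)`!%:R * (d + i.+1)`!%:R) =
    d`!%:R ^+ 2 / ((d - i)`!%:R * (d + i)`!%:R) *
    ((d - i)%:R / (d + i).+1%:R) :> R.
  have -> : (d - i = (d - i.+1).+1)%N by lia.
  rewrite addnS !factS !natrM.
  have fact_neq0 k : k`!%:R != 0 :> R by rewrite pnatr_eq0 -lt0n fact_gt0.
  have := fact_neq0 (d - i.+1)%N; have := fact_neq0 (d + i)%N.
  have : (d - i.+1).+1%:R != 0 :> R by rewrite pnatr_eq0.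
  have : (d + i).+1%:R != 0 :> R by rewrite pnatr_eq0.
  move: (d`!%:R) ((d + i).+1%:R) ((d - i.+1).+1%:R) ((d + i)`!%:R)
    ((d - i.+1)`!%:R) => u v w y z v0 w0 y0 z0.
  by field; rewrite v0 w0 y0 z0.
have -> : - (i.+1%:R ^+ 2 / (2 * d%:R)) =
    - (i%:R ^+ 2 / (2 * d%:R)) + - ((2 * i%:R + 1) / (2 * d%:R)) :> R.
  by rewrite -natr1; field; rewrite gt_eqF.
rewrite powRD; last by rewrite pnatr_eq0 implybT.
apply: ler_pM; rewrite ?IHi 1?ltnW // ?divr_ge0 ?mulr_ge0 ?exprn_ge0 //.
have le_id : (i <= d)%N by apply: ltnW.
have lt_id' : i%:R + 1 <= d%:R :> R by rewrite natr1 ler_nat.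
have i_ge0 : 0 <= i%:R :> R by [].
apply: le_trans (sub1_le_pow2N _); last first.
  by apply: divr_ge0; lra.
rewrite natrB // -natr1 natrD; move: (i%:R) (d%:R) => a b in d_gt0 lt_id' i_ge0 *.
rewrite -subr_ge0 [leRHS](_ : _ = (2 * a + 1) * (b - a - 1) / (2 * b * (b + a + 1))).
  by rewrite divr_ge0 ?mulr_ge0 //; lra.
by field; rewrite !gt_eqF //; lra.
Qed.

(** * The nodes and the size of their weights *)

(* Here A = 2 m and Delta = 8 m + 1. *)
Definition node (m i : nat) : nat :=
  match i with
  | 0 => 0
  | 1 => 1
  | 2 => m.*2
  | j.+3 => (8 * m).+1 * j.+1 ^ 2
  end.

Lemma odd_node m i : odd (node m i) = odd i.
Proof.
case: i => [|[|[|i]]] //; first by rewrite /node odd_double.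
by rewrite /node oddM oddX /= oddM /= negbK.
Qed.

Section Node.
Variables (R : realType) (m : nat).
Hypothesis m_gt0 : (0 < m)%N.

Lemma node_incr : {homo node m : i j / (i < j)%N}.
Proof.
apply: (homo_ltn ltn_trans) => -[|[|[|i]]] //=; try nia.
Qed.

Definition weight (d i : nat) : R :=
  gap R (node m) d.+3 0 / gap R (node m) d.+3 i.

Lemma weight_gt0 d i : 0 < weight d i.
Proof. by rewrite divr_gt0 // gap_gt0 //; apply: node_incr. Qed.

Lemma weight0 d : weight d 0 = 1.
Proof. by rewrite /weight divff // gt_eqF // gap_gt0 //; apply: node_incr. Qed.

Lemma alternating_weight_eq0 d (p : {poly R}) : (size p <= d.+2)%N ->
  \sum_(i < d.+3) (-1) ^+ i * weight d i * p.[(node m i)%:R] = 0.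
Proof.
move=> le_pd; have := alternating_gap_eq0 node_incr le_pd.
move/(congr1 ( *%R (gap R (node m) d.+3 0))).
rewrite mulr0 mulr_sumr => alt0; rewrite -[RHS]alt0.
by apply: eq_bigr => i _; rewrite /weight; ring.
Qed.

Lemma gap_node0 d : gap R (node m) d.+3 0 =
  m.*2%:R * \prod_(j < d) (node m j.+3)%:R.
Proof.
rewrite /gap big_mkcond !big_ord_recl /= mul1r /bump /= !sub0r !normrN.
rewrite normr1 mul1r normr_nat; congr (_ * _); apply: eq_bigr => j _.
by rewrite sub0r normrN normr_nat.
Qed.

Lemma gap_node2 d : gap R (node m) d.+3 2 =
  m.*2%:R * (m.*2%:R - 1) * \prod_(j < d) ((node m j.+3)%:R - m.*2%:R).
Proof.
rewrite /gap big_mkcond !big_ord_recl /= /bump /= mul1r subr0 normr_nat.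
rewrite ger0_norm ?subr_ge0 ?ler1n ?double_gt0 // mulrA.
congr (_ * _); apply: eq_bigr => j _.
rewrite distrC ger0_norm // subr_ge0 ler_nat ltnW //.
by rewrite (node_incr (isT : (2 < j.+3)%N)).
Qed.

Lemma gap_nodeSSS d (i : nat) : (i < d)%N -> gap R (node m) d.+3 i.+3 =
  (node m i.+3)%:R * ((node m i.+3)%:R - 1) * ((node m i.+3)%:R - m.*2%:R) *
  \prod_(j < d | j != i :> nat) `|(node m i.+3)%:R - (node m j.+3)%:R|.
Proof.
move=> lt_id; rewrite /gap big_mkcond !big_ord_recl /= /bump /= subr0 normr_nat.
rewrite !ger0_norm ?subr_ge0 ?ler1n ?ler_nat; last 2 first.
- by rewrite ltnW // (node_incr (isT : (2 < i.+3)%N)).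
- by rewrite muln_gt0 /= expn_gt0.
by rewrite !mulrA; congr (_ * _); rewrite [RHS]big_mkcond.
Qed.

(** The weight is [1 / ((2 m - 1) Q)], where [Q] is the product of the [1 - 2 m / t] over the square
    nodes [t]. Since [2 m / (8 m + 1) <= 1/4] and the inverse squares add up to at most 2, the
    product inequality gives [Q >= 1/2]. *)
Lemma weight2_le d : weight d 2 <= 2 / m%:R.
Proof.
rewrite /weight gap_node0 gap_node2.
have m1 : 1 <= m%:R :> R by rewrite ler1n.
have mE : m.*2%:R = 2 * m%:R :> R by rewrite -mul2n natrM.
have nodeE (j : nat) : (node m j.+3)%:R = (8 * m%:R + 1) * j.+1%:R ^+ 2 :> R.
  by rewrite /node natrM natrX -natr1 natrM.
have node_gt0 (j : nat) : 0 < (node m j.+3)%:R :> R.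
  by rewrite ltr0n muln_gt0 expn_gt0.
have -> : \prod_(j < d) ((node m j.+3)%:R - m.*2%:R) =
    \prod_(j < d) (node m j.+3)%:R *
    \prod_(j < d) (1 - m.*2%:R / (node m j.+3)%:R) :> R.
  rewrite -big_split /=; apply: eq_bigr => j _.
  by rewrite mulrBr mulr1 mulrCA divff ?mulr1 // gt_eqF.
set P := \prod_(j < d) _; set Q := \prod_(j < d) _.
have P_gt0 : 0 < P by apply: prodr_gt0.
have Q_ge : 2^-1 <= Q.
  apply: le_trans (prod1B_ge _) => [|j].
    have -> : \sum_(j < d) m.*2%:R / (node m j.+3)%:R =
        (m.*2%:R / (8 * m%:R + 1)) * \sum_(j < d) j.+1%:R ^- 2 :> R.
      rewrite mulr_sumr; apply: eq_bigr => j _.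
      by rewrite nodeE invfM mulrA.
    have S2 := sum_inv_sq_le2 R d.
    have le4 : m.*2%:R / (8 * m%:R + 1) <= 4^-1 :> R.
      by rewrite mE ler_pdivrMr; lra.
    have : m.*2%:R / (8 * m%:R + 1) * \sum_(j < d) j.+1%:R ^- 2 <= 4^-1 * 2 :> R.
      apply: ler_pM => //.
      by apply: sumr_ge0 => j _; rewrite invr_ge0 exprn_ge0.
    by lra.
  rewrite divr_ge0 // ?(ltW (node_gt0 _)) // ler_pdivrMr // mul1r ler_nat.
  by rewrite ltnW // (node_incr (isT : (2 < j.+3)%N)).
rewrite mE [leLHS](_ : _ = ((2 * m%:R - 1) * Q)^-1); last first.
  by field; rewrite !gt_eqF //; lra.
rewrite -[leRHS]invrK lef_pV2 ?posrE; last 2 first.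
- by apply: mulr_gt0; lra.
- by rewrite invr_gt0 divr_gt0; lra.
by rewrite invf_div; nra.
Qed.

(** At the node [t] the weight is [4 m / ((t - 1) (t - 2 m))] times the central ratio. Since
    [t >= 8 m + 1], both factors of the denominator are at least [t / 2]. *)
Lemma weightSSS_le d i : (i < d)%N ->
  weight d i.+3 <= 16 * m%:R / (node m i.+3)%:R ^+ 2 *
    2 `^ (- (i.+1%:R ^+ 2 / (2 * d%:R))).
Proof.
move=> lt_id; have m1 : 1 <= m%:R :> R by rewrite ler1n.
have mE : m.*2%:R = 2 * m%:R :> R by rewrite -mul2n natrM.
have nodeE (j : nat) : (node m j.+3)%:R = (8 * m%:R + 1) * j.+1%:R ^+ 2 :> R.
  by rewrite /node natrM natrX -natr1 natrM.
have node_gt0 (j : nat) : 0 < (node m j.+3)%:R :> R.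
  by rewrite ltr0n muln_gt0 expn_gt0.
have E : \prod_(j < d) (node m j.+3)%:R / \prod_(j < d | j != i :> nat)
    `|(node m i.+3)%:R - (node m j.+3)%:R| =
    (node m i.+3)%:R * (2 * (d`!%:R ^+ 2 /
      ((d - i.+1)`!%:R * (d + i.+1)`!%:R))) :> R.
  rewrite (bigD1 (Ordinal lt_id)) //= -mulrA -prod_sqr_ratio //.
  congr (_ * _); rewrite -prodfV -big_split /=.
  apply: eq_bigr => j _; rewrite !nodeE -mulrBr normrM.
  rewrite (ger0_norm (_ : 0 <= 8 * m%:R + 1)); last by lra.
  by rewrite invfM mulrACA divff ?mul1r // gt_eqF //; lra.
have bound := central_ratio_le R lt_id.
set b := d`!%:R ^+ 2 / _ in E bound; set B := _ `^ _ in bound *.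
rewrite /weight gap_node0 gap_nodeSSS // -/(node m i.+3).
set t : R := (node m i.+3)%:R in E *.
set P := \prod_(j < d) _ in E *; set G := \prod_(_ < _ | _) _ in E *.
have t_ge : 8 * m%:R + 1 <= t.
  by rewrite /t nodeE ler_peMr ?exprn_ege1 ?ler1n //; lra.
have -> : m.*2%:R * P / (t * (t - 1) * (t - m.*2%:R) * G) =
    4 * m%:R / ((t - 1) * (t - 2 * m%:R)) * b.
  rewrite [LHS](_ : _ = 2 * m%:R / (t * (t - 1) * (t - 2 * m%:R)) * (P / G)).
    by rewrite E; field; rewrite !gt_eqF //; lra.
  by rewrite mE invfM; ring.
apply: ler_pM => //; rewrite ?divr_ge0 ?mulr_ge0 ?exprn_ge0 //; try lra.
rewrite ler_pdivrMr; last by apply: mulr_gt0; lra.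
rewrite mulrAC ler_pdivlMr; last by rewrite exprn_gt0 //; lra.
have le4 : t / 2 * (t / 2) <= (t - 1) * (t - 2 * m%:R).
  by apply: ler_pM; lra.
rewrite -subr_ge0 [leRHS](_ : _ = 16 * m%:R *
  ((t - 1) * (t - 2 * m%:R) - t / 2 * (t / 2))); last by field.
by rewrite mulr_ge0 ?subr_ge0 ?mulr_ge0.
Qed.

Lemma sum_weight_le d : \sum_(i < d.+3) weight d i <= 2 * (1 + 3 / m%:R).
Proof.
have m1 : 1 <= m%:R :> R by rewrite ler1n.
have alt0 : \sum_(i < d.+3) (-1) ^+ i * weight d i = 0.
  have s1 : (size (1 : {poly R})%R <= d.+2)%N by rewrite size_poly1.
  rewrite -[RHS](alternating_weight_eq0 s1); apply: eq_bigr => i _.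
  by rewrite hornerC mulr1.
(* Adding the vanishing alternating sum cancels the weights of odd index and doubles the others.
   What remains is 2 from the node 0, at most [4 / m] from the node [2 m], and a tail of at most
   [1 / m]. *)
have -> : \sum_(i < d.+3) weight d i =
    \sum_(i < d.+3) (weight d i + (-1) ^+ i * weight d i).
  by rewrite big_split /= alt0 addr0.
rewrite !big_ord_recl /= /bump /=.
have -> : weight d 0 + (-1) ^+ 0 * weight d 0 = 2 by rewrite weight0; ring.
rewrite [X in _ + (X + _)](_ : _ = 0); last by ring.
have w2 := weight2_le d.
have mV : 0 <= m%:R^-1 :> R by rewrite invr_ge0.
set S := \sum_(i < d) _; suff : S <= 1 / m%:R.
  by move: (weight d _) w2 => w w2 leS; rewrite expr2; lra.
have leS : S <= \sum_(i < d) ((2 * m%:R)^-1 * i.+1%:R ^- 2).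
  apply: ler_sum => i _; set w := weight _ _.
  have w_gt0 : 0 < w by apply: weight_gt0.
  apply: (@le_trans _ _ (2 * w)).
    by rewrite -signr_odd; case: odd; rewrite ?expr1 ?expr0; lra.
  have : w <= 16 * m%:R / (node m i.+3)%:R ^+ 2.
    apply: le_trans (weightSSS_le (ltn_ord i)) _.
    rewrite ler_piMr ?divr_ge0 ?mulr_ge0 ?exprn_ge0 //.
    rewrite powRN invf_le1 ?powR_gt0 // -[leLHS](powRr0 2) ler_powR ?ler1n //.
  have -> : (node m i.+3)%:R = (8 * m%:R + 1) * i.+1%:R ^+ 2 :> R.
    by rewrite /node natrM natrX -natr1 natrM.
  have : 1 <= i.+1%:R ^+ 2 :> R by rewrite exprn_ege1 // ler1n.
  move: (i.+1%:R ^+ 2) => q q1 lew.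
  suff : 16 * m%:R / ((8 * m%:R + 1) * q) ^+ 2 <= (4 * m%:R)^-1 * q^-1.
    rewrite (_ : (2 * m%:R)^-1 = 2 * (4 * m%:R)^-1); first by nra.
    by field; rewrite gt_eqF //; lra.
  rewrite -invfM ler_pdivrMr; last by rewrite exprn_gt0 ?mulr_gt0 //; lra.
  rewrite [leRHS]mulrC ler_pdivlMr; last by rewrite !mulr_gt0 //; lra.
  have h : 0 <= m%:R ^+ 2 * q * (q - 1).
    by rewrite !mulr_ge0 ?exprn_ge0 //; lra.
  by nra.
apply: le_trans leS _; rewrite -mulr_sumr.
have S2 := sum_inv_sq_le2 R d.
apply: le_trans (ler_wpM2l _ S2) _; first by rewrite invr_ge0 mulr_ge0.
by rewrite invfM mulrAC mulVf ?pnatr_eq0 // mul1r.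
Qed.
End Node.

(** * Weights on indices as functions on the integers *)

(** The push-forward along [s] of the weights of the first [k] indices; as a filtered sum it needs
    no inverse of [s]. *)
Definition spread (F : realFieldType) (s : nat -> nat) (w : nat -> F)
    (k t : nat) : F := \sum_(i < k | s i == t) w i.

Section Spread.
Variables (F : realFieldType) (s : nat -> nat) (w : nat -> F) (k : nat).

Lemma sum_spread L (g : nat -> F) : (forall i, (i < k)%N -> (s i <= L)%N) ->
  \sum_(t < L.+1) spread s w k t * g t = \sum_(i < k) w i * g (s i).
Proof.
move=> le_sL; pose s' (i : 'I_k) : 'I_L.+1 := inord (s i).
have s'E (i : 'I_k) : s' i = s i :> nat by rewrite inordK // ltnS le_sL.
rewrite [RHS](partition_big s' xpredT) //=; apply: eq_bigr => t _.
rewrite /spread mulr_suml; apply: eq_big => [i|i /eqP -> //].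
by rewrite -val_eqE /= s'E.
Qed.

Lemma spread_eq0 t : (forall i, (i < k)%N -> s i != t) -> spread s w k t = 0.
Proof. by move=> ne_st; rewrite /spread big1 // => i /negPn; rewrite ne_st. Qed.

Lemma spread_node i : injective s -> (i < k)%N -> spread s w k (s i) = w i.
Proof.
move=> s_inj lt_ik; rewrite /spread (big_pred1 (Ordinal lt_ik)) // => j.
by rewrite (inj_eq s_inj).
Qed.

Lemma spread_le (B : nat -> F) t : injective s -> (forall u, 0 <= B u) ->
  (forall i, (i < k)%N -> w i <= B (s i)) -> spread s w k t <= B t.
Proof.
move=> s_inj B_ge0 leB.
have [/existsP[i /eqP<-]|/existsPn ne_st] := boolP [exists i : 'I_k, s i == t].
  by rewrite spread_node ?leB.
by rewrite spread_eq0 // => i lt_ik; apply: (ne_st (Ordinal lt_ik)).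
Qed.

End Spread.

(** * The target size *)

Definition decay (R : realType) (c : R) (n t : nat) : R :=
  (t.+1%:R ^+ 2 * 2 `^ (c * t%:R / Num.sqrt n%:R))^-1.

Lemma decay_gt0 (R : realType) (c : R) n t : 0 < decay c n t.
Proof. by rewrite invr_gt0 mulr_gt0 ?exprn_gt0 ?powR_gt0. Qed.

Lemma sqrt_nat_ge1 (R : realType) n : (0 < n)%N -> 1 <= Num.sqrt n%:R :> R.
Proof. by move=> n_gt0; rewrite -[leLHS]sqrtr1 ler_wsqrtr // ler1n. Qed.

(** A lower bound free of [n] and [c], for the few nodes near 0: as [c <= 1 <= sqrt n], the exponent
    is at most [a]. *)
Lemma decay_ge (R : realType) (c : R) n t a : (0 < n)%N -> 0 <= c <= 1 ->
  (t <= a)%N -> (a.+1%:R ^+ 2 * 2 ^+ a)^-1 <= decay c n t.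
Proof.
move=> n_gt0 /andP[c0 c1] le_ta.
have sq1 := sqrt_nat_ge1 R n_gt0.
rewrite /decay lef_pV2 ?posrE ?mulr_gt0 ?exprn_gt0 ?powR_gt0 //.
apply: ler_pM; rewrite ?exprn_ge0 ?powR_ge0 //.
  by rewrite lerXn2r ?nnegrE // ler_nat.
rewrite -powR_mulrn // ler_powR ?ler1n //.
rewrite ler_pdivrMr; last by lra.
apply: (@le_trans _ _ a%:R); last by rewrite ler_peMr.
by rewrite (@le_trans _ _ t%:R) ?ler_nat // ler_piMl.
Qed.

(** * Sparse functions with nearly half of their mass at 0 *)

Lemma exists_scaled_sqrt q n : (0 < q)%N ->
  exists d, (q * d ^ 2 <= n < q * d.+1 ^ 2)%N.
Proof.
move=> q_gt0; elim: n => [|n [d /andP[le_dn lt_nd]]].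
  by exists 0%N; rewrite muln0 muln1.
have [ltS|leS] := ltnP n.+1 (q * d.+1 ^ 2); first by exists d; rewrite ltS ltnW.
exists d.+1; rewrite leS /=; apply: leq_ltn_trans lt_nd _.
by rewrite ltn_mul2l q_gt0 ltn_sqr /=.

Qed.

(* A sparse version of psi: alternating in sign, of the right high-degree
   orthogonality and decay, and with the mass at 0 almost 1/2, but vanishing at
   most points. It occupies only the first half of {0, ..., n}, so that on a
   longer interval one of its translate and its reflection fits around any
   point. *)
Record is_bump (R : realType) (eps K c : R) (n L D : nat) (f : nat -> R) :
    Prop := IsBump {
  bump_half : (L.*2 <= n.+1)%N;
  bump_deg : c * Num.sqrt n%:R <= D%:R;
  bump_supp : forall t, (L < t)%N -> f t = 0;
  bump_orth : forall p : {poly R}, (size p <= D)%N ->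
    \sum_(t < L.+1) f t * p.[t%:R] = 0;
  bump_sign : forall t, 0 <= (-1) ^+ t * f t;
  bump0 : f 0%N = 1;
  bump_norm : \sum_(t < L.+1) `|f t| <= 2 * (1 + eps);
  bump_decay : forall t, `|f t| <= K * decay c n t }.

Lemma sparse_bump (R : realType) (eps : R) (m n d : nat) :
    let q := (8 * m).+1 in let c := (2 * q%:R)^-1 : R in
    (0 < m)%N -> 3 / m%:R <= eps -> (0 < d)%N ->
    (2 * q * d ^ 2 <= n < 2 * q * d.+1 ^ 2)%N ->
  is_bump eps (64 * (m.*2.+1%:R ^+ 2 * 2 ^+ m.*2)) c n
    (q * d ^ 2) d.+2 (fun t => (-1) ^+ t * spread (node m) (weight R m d) d.+3 t).
Proof.
move=> q c m_gt0 le_eps d_gt0 /andP[le_dn lt_nd].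
have incr := node_incr m_gt0.
have inj : injective (node m).
  by move=> i j eq_s; case: (ltngtP i j) => // /incr; rewrite eq_s ltnn.
have n_gt0 : (0 < n)%N.
  by apply: leq_trans le_dn; rewrite !muln_gt0 d_gt0.
have q1 : 1 <= q%:R :> R by rewrite ler1n.
have c01 : 0 <= c <= 1.
  by rewrite invr_ge0 mulr_ge0 //= invf_le1 ?mulr_gt0 //; lra.
have node_le i : (i < d.+3)%N -> (node m i <= q * d ^ 2)%N.
  have -> : (q * d ^ 2 = node m d.+2)%N by case: (d) d_gt0.
  by rewrite ltnS leq_eqVlt => /predU1P[-> //|/incr/ltnW].
have w_gt0 i := weight_gt0 R m_gt0 d i.
have spread_ge0 t : 0 <= spread (node m) (weight R m d) d.+3 t.
  by apply: sumr_ge0 => i _; apply: ltW.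
have normE t : `|(-1) ^+ t * spread (node m) (weight R m d) d.+3 t| =
    spread (node m) (weight R m d) d.+3 t.
  by rewrite normrM normrX normrN1 expr1n mul1r ger0_norm.
have sum_w := sum_weight_le R m_gt0 d.
split => //.
- by rewrite -mul2n mulnA (leq_trans le_dn).
- rewrite mulrC ler_pdivrMr ?mulr_gt0 ?ltr0n //.
  rewrite -[leRHS]gtr0_norm ?mulr_gt0 ?ltr0n // -sqrtr_sqr ler_wsqrtr //.
  rewrite -!natrM -natrX ler_nat (leq_trans (ltnW lt_nd)) //.
  rewrite expnMn [leqLHS]mulnC; apply: leq_mul; first by rewrite leq_sqr.
  by rewrite -mulnn leq_pmulr.
- move=> t lt_t; rewrite spread_eq0 ?mulr0 // => i /node_le le_i.
  by rewrite neq_ltn (leq_ltn_trans le_i lt_t).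
- move=> p le_p.
  pose g t := (-1) ^+ t * p.[t%:R].
  rewrite (eq_bigr (fun t : 'I_(q * d ^ 2).+1 =>
      spread (node m) (weight R m d) d.+3 t * g t)); last first.
    by move=> t _; rewrite /g; ring.
  rewrite (sum_spread _ _ node_le) -[RHS](alternating_weight_eq0 m_gt0 le_p).
  (* Every node has the parity of its index, so the sign at the node is the sign of the index. *)
  apply: eq_bigr => i _; rewrite /g -signr_odd odd_node signr_odd; ring.
- by move=> t; rewrite mulrA -expr2 sqrr_sign mul1r.
- by rewrite mul1r (spread_node _ inj (isT : (0 < d.+3)%N)) weight0.
- under eq_bigr do rewrite normE.
  rewrite (eq_bigr (fun t : 'I_(q * d ^ 2).+1 =>
      spread (node m) (weight R m d) d.+3 t * 1)); last first.
    by move=> t _; rewrite mulr1.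
  rewrite (sum_spread _ (fun=> 1) node_le); under eq_bigr do rewrite mulr1.
  by apply: le_trans sum_w _; lra.
set K := 64 * _; have K_ge : 64 * m%:R <= K.
  rewrite ler_pM2l // -[leLHS]mulr1 ler_pM ?exprn_ege1 ?ler1n //.
  by rewrite -natrX ler_nat; nia.
have K_gt0 : 0 < K by rewrite !mulr_gt0 ?exprn_gt0.
move=> t; rewrite normE; apply: (spread_le (B := fun u => K * decay c n u)) => //.
  by move=> u; rewrite mulr_ge0 ?ltW ?decay_gt0.
(* At the nodes 0, 1 and [2 m] the weight is at most the total mass, which is at most 8; the other
   factors of [K] come from [decay_ge] with [a = 2 m]. *)
have small i : (i < 3)%N -> weight R m d i <= K * decay c n (node m i).
  move=> lt_i3; apply: (@le_trans _ _ 64).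
    have lt_id : (i < d.+3)%N by lia.
    apply: (@le_trans _ _ (\sum_(i < d.+3) weight R m d i)).
      rewrite (bigD1 (Ordinal lt_id)) //= lerDl.
      by apply: sumr_ge0 => j _; apply: ltW.
    have : 3 / m%:R <= 3 :> R by rewrite ler_pdivrMr ?ltr0n // ler_peMr ?ler1n.
    by lra.
  rewrite -ler_pdivrMl // mulrC.
  apply: le_trans (decay_ge (a := m.*2) n_gt0 c01 _); last first.
    by case: i lt_i3 => [|[|[|]]] //= _; lia.
  by rewrite /K invfM mulrA divff ?mul1r.
move=> [|[|[|i]]] lt_i; try exact: small.
rewrite !ltnS in lt_i; apply: le_trans (weightSSS_le R m_gt0 lt_i) _.
set t0 := node m i.+3; have t0_ge1 : 1 <= t0%:R :> R.
  by rewrite ler1n /t0 muln_gt0 expn_gt0.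
rewrite /decay [X in K * X]invfM mulrA -powRN.
apply: ler_pM; rewrite ?powR_ge0 //.
  rewrite ler_pdivrMr ?exprn_gt0 //.
  rewrite mulrAC ler_pdivlMr ?exprn_gt0 // -[t0.+1%:R]natr1.
  apply: (@le_trans _ _ (64 * m%:R * t0%:R ^+ 2)); last first.
    by rewrite ler_wpM2r ?exprn_ge0.
  have m_ge0 : 0 <= m%:R :> R by [].
  rewrite (_ : 64 * m%:R * t0%:R ^+ 2 = 16 * m%:R * (2 * t0%:R) ^+ 2); last by ring.
  rewrite ler_wpM2l ?mulr_ge0 // lerXn2r ?nnegrE //; lra.
(* The choice [c = 1 / (2 q)] makes [c * t0] half the square of [i.+1]; the exponents then compare
   because [d <= sqrt n]. *)
rewrite ler_powR ?ler1n // lerN2.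
have -> : c * t0%:R = i.+1%:R ^+ 2 / 2.
  rewrite /c /t0 /node -/q natrM natrX.
  by move: (q%:R) (i.+1%:R) q1 => y x y1; field; rewrite gt_eqF //; lra.
rewrite -mulrA -invfM ler_wpM2l ?exprn_ge0 // lef_pV2 ?posrE ?mulr_gt0 ?sqrtr_gt0 ?ltr0n //.
rewrite ler_pM2l // -[leLHS]ger0_norm // -sqrtr_sqr ler_wsqrtr //.
by rewrite -natrX ler_nat (leq_trans _ le_dn) // leq_pmull.
Qed.

(** For bounded [n] the degree 1 is enough, as [c sqrt n <= c n <= 1], and a difference of point
    masses at 0 and 1 serves. Its support meets the bound [L.*2 <= n.+1] already at [n = 1]. *)
Lemma pair_bump (R : realType) (eps K c : R) (a n : nat) : (0 < n)%N ->
  0 <= eps -> 0 <= c <= 1 -> c * n%:R <= 1 -> (0 < a)%N ->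
  a.+1%:R ^+ 2 * 2 ^+ a <= K ->
  is_bump eps K c n 1 1 (fun t => if (t <= 1)%N then (-1) ^+ t else 0).
Proof.
move=> n_gt0 eps_ge0 c01 cn a_gt0 K_ge; have /andP[c_ge0 c_le1] := c01.
have K_gt0 : 0 < K by apply: lt_le_trans K_ge; rewrite mulr_gt0 ?exprn_gt0.
split => //.
- apply: le_trans cn; rewrite ler_wpM2l //.
  rewrite -[leRHS]ger0_norm // -sqrtr_sqr ler_wsqrtr // -natrX ler_nat.
  by rewrite -mulnn leq_pmulr.
- by move=> t; rewrite ltnNge => /negbTE ->.
- move=> p /size1_polyC ->; rewrite !big_ord_recr big_ord0 /= !hornerC; ring.
- by move=> t; case: ifP; rewrite ?mulr0 // -expr2 sqrr_sign.
- rewrite !big_ord_recr big_ord0 /= expr0 expr1 normrN normr1; lra.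
move=> t; have [le_t1|_] := leqP t 1; last first.
  by rewrite normr0 mulr_ge0 ?ltW ?decay_gt0.
rewrite normrX normrN1 expr1n -ler_pdivrMl // mulr1.
apply: le_trans (decay_ge (a := a) n_gt0 c01 _); last exact: leq_trans a_gt0.
by rewrite lef_pV2 ?posrE // mulr_gt0 ?exprn_gt0.
Qed.

Lemma exists_bump (R : realType) (eps : R) : 0 < eps ->
  exists K c : R, [/\ 0 < K, 0 < c & c < 1] /\
    forall n, (0 < n)%N -> exists L D f, is_bump eps K c n L D f.
Proof.
(* The excess mass [3 / m] must not exceed [eps]. *)
move=> eps_gt0; pose m := (Num.trunc (3 / eps)).+1.
have le_eps : 3 / m%:R <= eps.
  rewrite ler_pdivrMr ?ltr0n // mulrC -ler_pdivrMr //.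
  by rewrite ltW // truncnS_gt.
pose q := (8 * m).+1; pose c : R := (2 * q%:R)^-1.
pose K : R := 64 * (m.*2.+1%:R ^+ 2 * 2 ^+ m.*2).
have q1 : 1 <= q%:R :> R by rewrite ler1n.
exists K, c; split; first split.
- by apply: mulr_gt0 => //; apply: mulr_gt0; apply: exprn_gt0.
- by rewrite invr_gt0 mulr_gt0 //; lra.
- by rewrite invf_lt1; lra.
move=> n n_gt0.
have [//|d /andP[le_dn lt_nd]] := @exists_scaled_sqrt (2 * q) n.
(* If [d = 0], then [n < 2 q], that is, [c n < 1]: the case of the pair. *)
have [d0|d_gt0] := posnP d; last first.
  do 3 eexists; apply: (sparse_bump (d := d)) => //.
  by rewrite -/q le_dn.
do 3 eexists; apply: (pair_bump (a := m.*2)) => //.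
- exact: ltW.
- by rewrite invr_ge0 mulr_ge0 //= invf_le1; lra.
- rewrite mulrC ler_pdivrMr; last by lra.
  by rewrite mul1r -natrM ler_nat; rewrite d0 exp1n muln1 in lt_nd; apply: ltnW.
- by rewrite ler_peMl ?ler1n // mulr_ge0 ?exprn_ge0.
Qed.

(** * Convolution, summation and monotonicity of the target size *)

(** The exponentials multiply exactly. With [x = u + 1] and [y = t - u + 1],
    [(t + 1)^2 <= (x + y)^2 <= 2 x^2 + 2 y^2]; dividing by [x^2 y^2] leaves two sums of inverse
    squares, each at most 2 and taken twice. *)
Lemma decay_conv (R : realType) (c : R) (n t : nat) :
  \sum_(u < t.+1) decay c n u * decay c n (t - u) <= 8 * decay c n t.
Proof.
pose E x : R := 2 `^ (c * x%:R / Num.sqrt n%:R).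
have E_gt0 x : 0 < E x by apply: powR_gt0.
have decayE x : decay c n x = x.+1%:R ^- 2 * (E x)^-1 by rewrite /decay invfM.
apply: (@le_trans _ _ (\sum_(u < t.+1) (t.+1%:R ^- 2 * (E t)^-1) *
    (2 * u.+1%:R ^- 2 + 2 * (t - u).+1%:R ^- 2))).
  apply: ler_sum => u _; have le_ut : (u <= t)%N by rewrite -ltnS.
  have EE : E t = E u * E (t - u)%N.
    rewrite /E -powRD; last by rewrite pnatr_eq0 implybT.
    by rewrite -mulrDl -mulrDr -natrD subnKC.
  rewrite !decayE EE (invfM (E u)) [leLHS]mulrACA.
  rewrite [leRHS]mulrAC ler_wpM2r //.
    by rewrite mulr_ge0 ?invr_ge0 ?ltW.
  have -> : t.+1%:R = u.+1%:R + (t - u).+1%:R - 1 :> R.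
    by apply: (addIr 1); rewrite subrK natr1 -natrD; congr (_%:R); lia.
  have : 1 <= u.+1%:R :> R by rewrite ler1n.
  have : 1 <= (t - u).+1%:R :> R by rewrite ler1n.
  move: (u.+1%:R) ((t - u).+1%:R) => x y y1 x1.
  rewrite [leRHS]mulrC ler_pdivlMr; last by rewrite exprn_gt0 //; lra.
  rewrite -subr_ge0 [leRHS](_ : _ = (2 * x ^+ 2 + 2 * y ^+ 2 -
    (x + y - 1) ^+ 2) / (x ^+ 2 * y ^+ 2)); last first.
    by field; rewrite !gt_eqF //; lra.
  have := sqr_ge0 (x - y).
  rewrite (_ : 2 * x ^+ 2 + _ - _ = (x - y) ^+ 2 + 2 * (x + y) - 1); last by ring.
  move: (_ ^+ 2) => z z_ge0; apply: divr_ge0; first by lra.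
  by apply: mulr_ge0; apply: exprn_ge0; lra.
rewrite -mulr_sumr big_split /= -!mulr_sumr mulrC -decayE.
rewrite ler_wpM2r ?(ltW (decay_gt0 _ _ _)) //.
have rev : \sum_(u < t.+1) ((t - u).+1%:R ^- 2 : R) =
    \sum_(u < t.+1) u.+1%:R ^- 2.
  rewrite (reindex_inj rev_ord_inj) /=; apply: eq_bigr => u _.
  by rewrite subSS subKn // -ltnS.
by have := sum_inv_sq_le2 R t.+1; rewrite rev; lra.
Qed.

Lemma sum_decay_le2 (R : realType) (c : R) (n k : nat) : 0 <= c ->
  \sum_(t < k) decay c n t <= 2.
Proof.
move=> c_ge0; apply: le_trans (sum_inv_sq_le2 R k); apply: ler_sum => t _.
rewrite /decay invfM ler_piMr ?invr_ge0 ?exprn_ge0 //.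
rewrite invf_le1 ?powR_gt0 // -[leLHS](powRr0 2) ler_powR ?ler1n //.
by rewrite divr_ge0 ?mulr_ge0 ?sqrtr_ge0.
Qed.

Lemma decay_homo (R : realType) (c : R) (n t u : nat) : 0 <= c ->
  (t <= u)%N -> decay c n u <= decay c n t.
Proof.
move=> c_ge0 le_tu; rewrite /decay lef_pV2 ?posrE ?mulr_gt0 ?exprn_gt0 ?powR_gt0 //.
apply: ler_pM; rewrite ?exprn_ge0 ?powR_ge0 //.
  by rewrite lerXn2r ?nnegrE // ler_nat ltnS.
rewrite ler_powR ?ler1n // ler_wpM2r ?invr_ge0 ?sqrtr_ge0 //.
by rewrite ler_wpM2l // ler_nat.
Qed.

(** * Superposition of translates and reflections *)

Section Superposition.
Variables (R : realType) (eps K c : R) (n N L D : nat) (f : nat -> R).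
Hypothesis le_nN : (n <= N)%N.
Hypothesis f_bump : is_bump eps K c n L D f.

Lemma bump_norm_le k : \sum_(0 <= t < k) `|f t| <= 2 * (1 + eps).
Proof.
apply: le_trans (bump_norm f_bump); rewrite -(big_mkord xpredT (fun t => `|f t|)).
have [le_kL|lt_Lk] := leqP k L.+1.
  by rewrite (big_cat_nat (n := k) (p := L.+1)) //= lerDl sumr_ge0.
rewrite (big_cat_nat (n := L.+1)) 1?ltnW //= gerDl big_nat big1 // => t.
by case/andP => lt_Lt _; rewrite (bump_supp f_bump) // normr0.
Qed.

(** The copy of [f] with its peak at [T] extends to the right from the left half and to the left
    from the right half. The guards keep truncated subtraction from reading [f 0] on the wrong
    side. *)
Definition shifted (T t : nat) : R :=
  if (T.*2 <= N)%N then (if (T <= t)%N then f (t - T)%N else 0)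
  else if (t <= T)%N then f (T - t)%N else 0.

Definition place (T u : nat) : nat :=
  if (T.*2 <= N)%N then (T + u)%N else (T - u)%N.

(** A general [G] vanishing at the value 0 covers both norms and correlations. *)
Lemma sum_shifted T (G : R -> nat -> R) : (T <= N)%N ->
  (forall t, G 0 t = 0) ->
  \sum_(t < N.+1) G (shifted T t) t = \sum_(u < L.+1) G (f u) (place T u).
Proof.
move=> le_TN G0; have half := bump_half f_bump.
rewrite -(big_mkord xpredT (fun t => G (shifted T t) t)).
rewrite -(big_mkord xpredT (fun u => G (f u) (place T u))) /shifted /place.
have [TN|TN] := leqP T.*2 N.
  (* Doubling gives [2 (T + L) <= 2 N + 1], and parity absorbs the extra 1. *)
  have le_TL : (T + L <= N)%N by lia.
  rewrite (big_cat_nat (n := T) (p := N.+1)) ?leqW //= big_nat big1 ?add0r => [|t]; last first.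
    by case/andP=> _; rewrite ltnNge => /negbTE ->.
  rewrite -[X in \sum_(X <= _ < _) _]add0n big_addn.
  have le_LN : (L.+1 <= N.+1 - T)%N by lia.
  rewrite (big_cat_nat (leq0n _) le_LN) /=.
  rewrite [X in _ + X]big_nat [X in _ + X]big1 ?addr0 => [|u /andP[lt_Lu _]]; last first.
    by rewrite leq_addl addnK (bump_supp f_bump).
  by apply: eq_bigr => u _; rewrite leq_addl addnK addnC.
have le_LT : (L <= T)%N by lia.
rewrite (big_cat_nat (n := T.+1)) //= [X in _ + X]big_nat.
rewrite [X in _ + X]big1 ?addr0 => [|t]; last first.
  by case/andP=> lt_Tt _; rewrite leqNgt lt_Tt.
rewrite big_nat_rev /= (big_cat_nat (n := L.+1)) //=.
rewrite [X in _ + X]big_nat [X in _ + X]big1 ?addr0; last first.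
  move=> u /andP[lt_Lu lt_uT]; rewrite add0n subSS leq_subr subKn //.
  by rewrite (bump_supp f_bump).
rewrite big_nat [RHS]big_nat; apply: eq_bigr => u /andP[_ lt_uL].
by rewrite add0n subSS leq_subr subKn //; lia.
Qed.

Lemma sign_bump t : (-1) ^+ t * `|f t| = f t.
Proof.
have := bump_sign f_bump t; set s : R := (-1) ^+ t => sf_ge0.
rewrite (_ : `|f t| = s * f t); first by rewrite mulrA -expr2 sqrr_sign mul1r.
by rewrite -(ger0_norm sf_ge0) normrM normrX normrN1 expr1n mul1r.
Qed.

(** Substituting [T + X] or [T - X] in [p] preserves its size, and since [T + u] and [T - u] have
    equal parity, the signs change by the common factor [(-1)^T]. *)
Lemma shifted_orth T (p : {poly R}) : (T <= N)%N -> (size p <= D)%N ->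
  \sum_(t < N.+1) (-1) ^+ t * `|shifted T t| * p.[t%:R] = 0.
Proof.
move=> le_TN le_pD; have half := bump_half f_bump.
rewrite (sum_shifted (G := fun y t => (-1) ^+ t * `|y| * p.[t%:R])) //; last first.
  by move=> t; rewrite normr0 mulr0 mul0r.
have [le_T|gt_T] := leqP T.*2 N.
  pose r : {poly R} := p \Po ('X + T%:R%:P).
  have le_rD : (size r <= D)%N by rewrite size_comp_poly2 // size_XaddC.
  transitivity ((-1) ^+ T * \sum_(u < L.+1) f u * r.[u%:R]).
    rewrite mulr_sumr; apply: eq_bigr => u _; rewrite /place le_T.
    rewrite -[f u in RHS]sign_bump exprD horner_comp hornerD hornerX hornerC.
    by rewrite -natrD addnC !mulrA.
  by rewrite (bump_orth f_bump) ?mulr0.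
pose r : {poly R} := p \Po (T%:R%:P - 'X).
have le_rD : (size r <= D)%N.
  rewrite size_comp_poly2 // -opprB size_polyN size_XsubC //.
transitivity ((-1) ^+ T * \sum_(u < L.+1) f u * r.[u%:R]).
  rewrite mulr_sumr; apply: eq_bigr => u _.
  rewrite /place leqNgt gt_T /= -[f u in RHS]sign_bump.
  have le_uT : (u <= T)%N by have := ltn_ord u; lia.
  rewrite horner_comp hornerD hornerN hornerX hornerC -natrB // -signr_odd oddB // signr_addb.
  by rewrite !signr_odd !mulrA.
by rewrite (bump_orth f_bump) ?mulr0.
Qed.

Lemma sum_norm_shifted T : (T <= N)%N ->
  \sum_(t < N.+1) `|shifted T t| <= 2 * (1 + eps).
Proof.
move=> le_TN; rewrite (sum_shifted (G := fun y _ => `|y|)) //; last first.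
  by move=> _; rewrite normr0.
exact: (bump_norm f_bump).
Qed.

Lemma shifted_id T : shifted T T = 1.
Proof. by rewrite /shifted leqnn subnn (bump0 f_bump) if_same. Qed.

(** Copies peaking at [T <= t] add up to a convolution, bounded by [decay_conv]. For [T >= t] the
    coefficient is at most [decay c n t], and the values of [f] add up to at most its norm. *)
Lemma superposition_le t : 0 <= c -> 0 <= K -> (t <= N)%N ->
  \sum_(T < N.+1) decay c n T * `|shifted T t| <=
  (8 * K + 2 * (1 + eps)) * decay c n t.
Proof.
move=> c_ge0 K_ge0 le_tN; rewrite mulrDl.
have dec_ge0 u : 0 <= decay c n u by apply: ltW (decay_gt0 _ _ _).
pose a T := if (T <= t)%N then decay c n T * `|f (t - T)%N| else 0.
pose b T := if (t <= T)%N then decay c n T * `|f (T - t)%N| else 0.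
have a_ge0 T : 0 <= a T by rewrite /a; case: ifP => // _; rewrite mulr_ge0.
have b_ge0 T : 0 <= b T by rewrite /b; case: ifP => // _; rewrite mulr_ge0.
apply: (@le_trans _ _ (\sum_(T < N.+1) a T + \sum_(T < N.+1) b T)).
  rewrite -big_split /=; apply: ler_sum => T _; rewrite /shifted.
  have := a_ge0 T; have := b_ge0 T; rewrite /a /b.
  by do 2!case: ifP => _; case: ifP => _ *; rewrite ?normr0 ?mulr0; lra.
apply: lerD.
  rewrite -(big_mkord xpredT a) (big_cat_nat (n := t.+1)) //=.
  rewrite [X in _ + X]big_nat [X in _ + X]big1 ?addr0; last first.
    by move=> T /andP[lt_tT _]; rewrite /a leqNgt lt_tT.
  rewrite big_mkord -mulrA mulrCA.
  apply: le_trans (ler_wpM2l K_ge0 (decay_conv c n t)).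
  rewrite mulr_sumr; apply: ler_sum => T _; rewrite /a -ltnS ltn_ord mulrCA.
  by rewrite ler_wpM2l // (bump_decay f_bump).
rewrite -(big_mkord xpredT b) (big_cat_nat (n := t)) ?leqW //= big_nat.
rewrite big1 ?add0r => [|T /andP[_ lt_Tt]]; last by rewrite /b leqNgt lt_Tt.
apply: (@le_trans _ _ (\sum_(t <= T < N.+1) `|f (T - t)%N| * decay c n t)).
  rewrite big_nat [leRHS]big_nat; apply: ler_sum => T /andP[le_tT _].
  by rewrite /b le_tT mulrC ler_wpM2l // decay_homo.
rewrite -mulr_suml ler_wpM2r // -[X in \sum_(X <= _ < _) _]add0n big_addn.
under eq_bigr do rewrite addnK.
exact: bump_norm_le.
Qed.

End Superposition.

(** * Constants, normalization and verification *)

Theorem theorem3p3 (R : realType) (eps : R) (heps0 : 0 < eps) (heps1 : eps < 1) :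
  exists c' c'' : R,
    [/\ 0 < c', c' < 1, 0 < c'' & c'' < 1] /\
    forall N n : nat, (1 <= n)%N -> (n <= N)%N ->
      exists psi : 'I_N.+1 -> R,
        [/\ psi ord0 > (1 - eps) / 2,
            norm1 psi = 1,
            ((c' * Num.sqrt n%:R)%:E <= orth psi)%E,
            (forall t : 'I_N.+1, Num.sg (psi t) = (-1) ^+ t) &
            (forall t : 'I_N.+1,
               let d := (t.+1%:R) ^+ 2 * 2 `^ (c'' * t%:R / Num.sqrt n%:R) in
               `|psi t| \in `[c' / d, 1 / (c' * d)])].
Proof.
have [|K [c [[K_gt0 c_gt0 c_lt1] bumps]]] := @exists_bump R (eps / 2).
  by lra.
(* The three bounds serve the degree, the lower estimate ([eps / 4] divided by a total mass of at
   most 5) and the upper estimate. *)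
pose c' := Num.min c (Num.min (eps / 20) (9 * K + 3)^-1).
have c'_gt0 : 0 < c' by rewrite !lt_min c_gt0 invr_gt0; lra.
have [c'_le1 c'_le2 c'_le3] : [/\ c' <= c, c' <= eps / 20 & c' <= (9 * K + 3)^-1].
  by split; rewrite /c' !ge_min lexx ?orbT.
exists c', c; split; first by split => //; apply: le_lt_trans c_lt1.
move=> N n n_gt0 le_nN; have [L [D [f f_bump]]] := bumps n n_gt0.
have c_ge0 := ltW c_gt0; have K_ge0 := ltW K_gt0.
have dec_gt0 t := decay_gt0 c n t.
pose g T t := shifted N f T t.
pose S t : R := \sum_(T < N.+1) decay c n T * `|g T t|.
pose a t : R := `|f t| + eps / 4 * S t.
have S_ge0 t : 0 <= S t.
  by apply: sumr_ge0 => T _; rewrite mulr_ge0 // ltW.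
have a_ge t : (t <= N)%N -> eps / 4 * decay c n t <= a t.
  move=> le_tN; have lt_tN : (t < N.+1)%N by [].
  apply: (@le_trans _ _ (eps / 4 * S t)); last by rewrite lerDr.
  rewrite ler_wpM2l //; first by lra.
  rewrite /S (bigD1 (Ordinal lt_tN)) //= /g (shifted_id _ f_bump) normr1 mulr1.
  by rewrite lerDl; apply: sumr_ge0 => T _; rewrite mulr_ge0 // ltW.
have a_le t : (t <= N)%N -> a t <= (9 * K + 3) * decay c n t.
  move=> le_tN; have := superposition_le f_bump c_ge0 K_ge0 le_tN.
  have := bump_decay f_bump t; rewrite -/(S t) /a.
  have eps4 : eps / 4 * S t <= S t by rewrite ler_piMl //; lra.
  have M3 : (8 * K + 2 * (1 + eps / 2)) * decay c n t <=
      (8 * K + 3) * decay c n t by rewrite ler_wpM2r ?(ltW (dec_gt0 t)) //; lra.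
  by lra.
have a_gt0 t : (t <= N)%N -> 0 < a t.
  by move=> le_tN; apply: lt_le_trans (a_ge t le_tN); rewrite mulr_gt0 //; lra.
pose Z := \sum_(t < N.+1) a t.
(* The bump has norm at most [M = 2 (1 + eps / 2)]. The superposition has at most [2 M], as its
   coefficients add up to at most 2; scaled by [eps / 4] it adds [M eps / 2]. *)
have Z_le : Z <= 2 * (1 + eps / 2) ^+ 2.
  pose M := 2 * (1 + eps / 2).
  have f_le : \sum_(t < N.+1) `|f t| <= M.
    by rewrite -(big_mkord xpredT (fun t => `|f t|)) (bump_norm_le f_bump).
  have S_le : \sum_(t < N.+1) S t <= 2 * M.
    rewrite exchange_big /=.
    apply: (@le_trans _ _ (\sum_(T < N.+1) decay c n T * M)).
      apply: ler_sum => T _; rewrite -mulr_sumr ler_wpM2l ?(ltW (dec_gt0 _)) //.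
      by rewrite (sum_norm_shifted le_nN f_bump) // -ltnS.
    by rewrite -mulr_suml ler_wpM2r ?sum_decay_le2 //; rewrite /M; lra.
  rewrite /Z big_split /= -mulr_sumr.
  have := ler_wpM2l (_ : 0 <= eps / 4) S_le.
  by rewrite /M in f_le *; lra.
have a0_ge1 : 1 <= a 0%N.
  by rewrite /a (bump0 f_bump) normr1 lerDl mulr_ge0 //; lra.
have Z_ge1 : 1 <= Z.
  rewrite /Z big_ord_recl (le_trans a0_ge1) // lerDl sumr_ge0 // => t _.
  by rewrite ltW // a_gt0 // -ltnS.
have Z_gt0 : 0 < Z by lra.
pose psi (t : 'I_N.+1) : R := (-1) ^+ t * (a t / Z).
have normpsi t : `|psi t| = a t / Z.
  rewrite /psi normrM normrX normrN1 expr1n mul1r ger0_norm //.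
  by rewrite divr_ge0 ?ltW // a_gt0 // -ltnS.
exists psi; split.
- rewrite /psi expr0 mul1r ltr_pdivlMr //.
  apply: lt_le_trans a0_ge1; apply: (@le_lt_trans _ _ ((1 - eps) / 2 * (2 * (1 + eps / 2) ^+ 2))).
    by rewrite ler_wpM2l //; lra.
  rewrite -subr_gt0 [ltRHS](_ : _ = eps ^+ 2 * (3 + eps) / 4); last by field.
  by rewrite divr_gt0 ?mulr_gt0 ?exprn_gt0 //; lra.
- rewrite /norm1; under eq_bigr do rewrite normpsi.
  by rewrite -mulr_suml divff // gt_eqF.
- apply: le_ereal_inf_tmp => _ [p corr_p <-]; rewrite lee_fin.
  (* A size above [D] means degree at least [D]; any smaller [p] is shown not to correlate. *)
  have [le_pD|lt_Dp] := leqP (size p) D; last first.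
    apply: (@le_trans _ _ D%:R); last by rewrite ler_nat; lia.
    apply: le_trans (bump_deg f_bump); rewrite ler_wpM2r ?sqrtr_ge0 //.
  case: corr_p.
  have g_orth T : (T <= N)%N ->
      \sum_(t < N.+1) (-1) ^+ t * `|g T t| * p.[t%:R] = 0.
    by move=> le_TN; rewrite (shifted_orth le_nN f_bump).
  (* The bump is its own copy placed at 0. *)
  have f_orth : \sum_(t < N.+1) (-1) ^+ t * `|f t| * p.[t%:R] = 0.
    rewrite -[RHS](g_orth 0%N) //; apply: eq_bigr => t _.
    by rewrite /g /shifted subn0.
  transitivity (Z^-1 * (\sum_(t < N.+1) (-1) ^+ t * `|f t| * p.[t%:R] +
      eps / 4 * \sum_(T < N.+1) decay c n T *
        \sum_(t < N.+1) (-1) ^+ t * `|g T t| * p.[t%:R])); last first.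
    rewrite f_orth big1 ?mulr0 ?addr0 ?mulr0 // => T _.
    by rewrite g_orth ?mulr0 // -ltnS.
  rewrite [X in eps / 4 * X](_ : _ =
      \sum_(t < N.+1) (-1) ^+ t * S t * p.[t%:R]).
    rewrite mulr_sumr -big_split /= mulr_sumr.
    by apply: eq_bigr => t _; rewrite /psi /a; ring.
  under eq_bigr do rewrite mulr_sumr.
  rewrite exchange_big /=; apply: eq_bigr => t _.
  rewrite /S mulr_sumr mulr_suml; apply: eq_bigr => T _; ring.
- move=> t; rewrite /psi sgrM sgrX sgrN1 gtr0_sg ?mulr1 //.
  by rewrite divr_gt0 // a_gt0 // -ltnS.
move=> t; cbv zeta; set d := _ * _ `^ _; have le_tN : (t <= N)%N by rewrite -ltnS.
have dE : d^-1 = decay c n t by [].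
have d_gt0 := dec_gt0 t; have a_ge_t := a_ge t le_tN.
have a_le_t := a_le t le_tN.
rewrite in_itv /= normpsi div1r (invfM c') !dE; apply/andP; split.
  rewrite ler_pdivlMr //; apply: le_trans a_ge_t.
  have Z5 : Z <= 5 by nra.
  apply: (@le_trans _ _ (eps / 20 * decay c n t * 5)); last by lra.
  apply: ler_pM => //; rewrite ?mulr_ge0 ?(ltW d_gt0) ?(ltW c'_gt0) ?(ltW Z_gt0) //.
  by rewrite ler_wpM2r // ltW.
rewrite ler_pdivrMr //; apply: le_trans a_le_t _.
apply: (@le_trans _ _ (c'^-1 * decay c n t)).
  rewrite ler_wpM2r ?(ltW d_gt0) // -[leLHS]invrK lef_pV2 ?posrE //.
  by rewrite invr_gt0; lra.
by rewrite ler_peMr // mulr_ge0 ?invr_ge0 ?(ltW c'_gt0) ?(ltW d_gt0).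
Qed.
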